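(* Let $S \subset \mathbb{F}_2^n$, let $\tau, \delta \in (0,1)$, and let $m = \log_2(|S|(|S|-1)/\delta)$. Suppose $$|S| > 2^{20} m \max\left(\frac{2^8(1+\tau)^4}{(\tau\delta)^8},\, 1\right), \qquad m \geq 5\log_2\left(m\max\left(\frac{4(1+\tau)}{(\tau\delta)^2},\, 1\right)\right) + 25.$$ Then there exists a natural number $$t \geq \log_2|S| - 4\log_2\left(m\max\left(\frac{4(1+\tau)}{(\tau\delta)^2},\, 1\right)\right) - 20$$ such that at least a $(1-\delta)$-fraction of all surjective linear maps $L : \mathbb{F}_2^n \to \mathbb{F}_2^t$ are such that $L(U_S)$ is $\tau 2^{-t}$-close to uniform in the $\ell_\infty$ norm, i.e. $|\Pr[L(U_S)=y] - 2^{-t}| \leq \tau 2^{-t}$ for all $y \in \mathbb{F}_2^t$.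
   Context: $U_S$ denotes a random variable distributed uniformly on the finite set $S$. A random variable $X$ on a finite set $Y$ is $\epsilon$-close to uniform in the $\ell_\infty$ norm if $|\Pr[X=y] - 1/|Y|| \leq \epsilon$ for every $y \in Y$. *)

(* Defs.v *)
From HB Require Import structures.
From mathcomp Require Import all_boot all_order all_algebra.
From mathcomp Require Import reals exp.
Set Implicit Arguments. Unset Strict Implicit. Unset Printing Implicit Defensive.
Import Order.TTheory GRing.Theory Num.Theory.
Local Open Scope ring_scope.

Definition log2 (R : realType) (x : R) : R := ln x / ln 2.

(* Vectors of F_2^n are row vectors 'rV['F_2]_n; a linear map
   L : F_2^n -> F_2^t is represented by a matrix A : 'M['F_2]_(n,t),
   acting by x |-> x *m A.  L is surjective iff \rank A = t. *)
Definition surjlin (n t : nat) (A : 'M['F_2]_(n, t)) : bool := \rank A == t.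

Definition prLU (R : realType) (n t : nat) (S : {set 'rV['F_2]_n})
    (A : 'M['F_2]_(n, t)) (y : 'rV['F_2]_t) : R :=
  #|[set x in S | x *m A == y]|%:R / #|S|%:R.

Definition close_unif (R : realType) (n t : nat) (S : {set 'rV['F_2]_n})
    (A : 'M['F_2]_(n, t)) (eps : R) : bool :=
  [forall y : 'rV['F_2]_t, `|prLU R S A y - 1 / (#|{: 'rV['F_2]_t}|)%:R| <= eps].

(* Main.v *)
Require Import Defs.
From HB Require Import structures.
From mathcomp Require Import all_boot all_order all_algebra.
From mathcomp Require Import reals exp.
From mathcomp Require Import ring lra zify.
Set Implicit Arguments. Unset Strict Implicit. Unset Printing Implicit Defensive.
Import Order.TTheory GRing.Theory Num.Theory.
Local Open Scope ring_scope.

(** A double-sampling argument, which avoids the polynomial method. Refine a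
    uniform matrix A (n x t) by k further random affine coordinates
    x |-> x E + c, where t <= 2^k. If some bucket of A has a skewed size then, by
    pairwise independence and Chebyshev, with probability at least 1/2 all 2^k
    sub-buckets of that bucket are skewed. On the other hand the skewed
    sub-buckets have tiny density, again by Chebyshev. Replacing A by A + E P with
    P uniform turns "all sub-buckets of some bucket are skewed" into "some coset
    { (b + z P, z) : z in F_2^k } of a random k-dimensional subspace lies in a
    fixed sparse set". Adding the k generators one at a time squares the density
    at each step, so such a coset exists only with small probability. The loss
    is 2^(3k+7) / (tau delta)^2, well within the allowed (m M)^4 2^20. *)

(** * Counting and second moments *)

Lemma card_mx_ker (F : finFieldType) (n t : nat) (v : 'rV[F]_n) : v != 0 ->
  (#|[set A : 'M[F]_(n, t) | (v *m A == 0)%R]| * #|{: 'rV[F]_t}|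
     = #|{: 'M[F]_(n, t)}|)%N.
Proof.
move=> /rV0Pn [j vj].
(* [u] is a right inverse of [v], so translation by [u *m w] identifies the fibre of [A |-> v *m A]
   over [w] with the kernel: all fibres have equal size. *)
pose u : 'cV[F]_n := (v 0 j)^-1 *: delta_mx j 0.
have vu : v *m u = 1%:M.
  rewrite /u -scalemxAr -colE; apply/matrixP => a b.
  by rewrite !mxE !ord1 mulVf.
rewrite -[RHS]sum1_card (partition_big (fun A => v *m A) predT) //=.
rewrite mulnC -[in LHS]sum_nat_const; apply: eq_big => // w _.
rewrite -sum1_card (reindex (fun A : 'M[F]_(n, t) => A - u *m w)) /=; last first.
  by exists (fun A => A + u *m w) => A _; rewrite ?subrK ?addrK.
apply: eq_bigl => A; rewrite inE mulmxBr mulmxA vu mul1mx.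
by rewrite subr_eq0.
Qed.

Lemma natr_card_sum (R : pzSemiRingType) (T : finType) (P Q : pred T) :
  #|[set x | P x && Q x]|%:R = \sum_(x | P x) (Q x)%:R :> R.
Proof.
rewrite -sum1_card natr_sum [RHS]big_mkcond [LHS]big_mkcond /=.
by apply: eq_bigr => x _; rewrite inE; case: (P x); case: (Q x).
Qed.

Section SecondMoment.
Variables (R : realFieldType) (W X : finType) (H : W -> X -> bool) (p : R).
Hypothesis H1 : forall x, #|[set w | H w x]|%:R = p * #|W|%:R.
Hypothesis H2 : forall x x', x != x' ->
  #|[set w | H w x && H w x']|%:R = p ^+ 2 * #|W|%:R.

(** Expanding the square, the off-diagonal covariances vanish by pairwise independence, and each
    diagonal term is [p - p ^+ 2 <= p] on average. *)
Lemma second_moment (F : {set X}) : 0 <= p ->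
  \sum_w (#|[set x in F | H w x]|%:R - p * #|F|%:R) ^+ 2
    <= p * #|F|%:R * #|W|%:R.
Proof.
move=> p0.
have H1s x : \sum_w (H w x)%:R = p * #|W|%:R.
  by rewrite -(H1 x) -(natr_card_sum R predT (H^~ x)).
pose h w x : R := (H w x)%:R - p.
have hE w : #|[set x in F | H w x]|%:R - p * #|F|%:R = \sum_(x in F) h w x.
  by rewrite (natr_card_sum R (mem F) (H w)) sumrB sumr_const mulr_natr.
under eq_bigr => w _ do rewrite hE expr2 big_distrlr /=.
rewrite exchange_big /=.
apply: (@le_trans _ _ (\sum_(x in F) p * #|W|%:R)); last first.
  by rewrite sumr_const -mulr_natr; lra.
have hh x x' : \sum_w h w x * h w x' = \sum_w (H w x && H w x')%:R
   - p * \sum_w (H w x)%:R - p * \sum_w (H w x')%:R + p ^+ 2 * #|W|%:R.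
  rewrite mulr_natr -sumr_const !mulr_sumr -!sumrB -big_split /=.
  by apply: eq_bigr => w _; rewrite /h; case: (H w x); case: (H w x'); rewrite /=; ring.
apply: ler_sum => x xF; rewrite exchange_big (bigD1 x) //= [X in _ + X]big1 ?addr0.
  rewrite hh (eq_bigr (fun w => (H w x)%:R)) => [|w _]; last by rewrite andbb.
  rewrite !H1s; have := mulr_ge0 (sqr_ge0 p) (ler0n R #|W|); nra.
move=> x' /andP[_ nx].
by rewrite hh -(natr_card_sum R predT (fun w => H w x && H w x')) H2 1?eq_sym // !H1s; ring.
Qed.

Lemma chebyshev_card (F : {set X}) (l : R) : 0 <= p -> 0 <= l ->
  #|[set w | l <= `|#|[set x in F | H w x]|%:R - p * #|F|%:R|]|%:R * l ^+ 2
    <= p * #|F|%:R * #|W|%:R.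
Proof.
move=> p0 l0; apply: le_trans (second_moment F p0).
pose D w := #|[set x in F | H w x]|%:R - p * #|F|%:R.
rewrite (natr_card_sum R predT (fun w => l <= `|D w|)) mulr_suml.
apply: ler_sum => w _; case: (boolP (l <= `|D w|)) => hl; last first.
  by rewrite mul0r sqr_ge0.
by rewrite mul1r -[leRHS]real_normK ?num_real // lerXn2r ?nnegrE.
Qed.

End SecondMoment.

(** * Random shifts and coset covers *)

Lemma card_rV_F2 t : #|{: 'rV['F_2]_t}| = (2 ^ t)%N.
Proof. by rewrite card_mx mul1n card_Fp. Qed.

Lemma card_mxS (F : finFieldType) k t :
  #|{: 'M[F]_(1 + k, t)}| = (#|{: 'rV[F]_t}| * #|{: 'M[F]_(k, t)}|)%N.
Proof. by rewrite !card_mx mulnDl expnD. Qed.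

Lemma markov_card (R : realFieldType) (T : finType) (f : T -> R) (a : R) :
  (forall x, 0 <= f x) -> 0 <= a ->
  #|[set x | a < f x]|%:R * a <= \sum_x f x.
Proof.
move=> f0 a0; rewrite (natr_card_sum R predT (fun x => a < f x)) mulr_suml.
apply: ler_sum => x _; case: (boolP (a < f x)) => h; last by rewrite mul0r.
by rewrite mul1r ltW.
Qed.

(** For fixed [b], exactly [#|C|] shifts send [b] into [C]. Thus under a random shift the expected
    density of the intersection is the product of the densities. *)
Lemma sum_card_shift (V : finZmodType) (B C : {set V}) :
  (\sum_(p : V) #|[set b in B | (b + p)%R \in C]| = #|B| * #|C|)%N.
Proof.
under eq_bigr => p _ do rewrite -sum1_card big_mkcond.
rewrite exchange_big /= -[RHS]sum_nat_const [RHS]big_mkcond; apply: eq_bigr => b _.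
case: (boolP (b \in B)) => bB; last by rewrite big1 // => p _; rewrite inE (negPf bB).
rewrite -sum1_card [RHS]big_mkcond [RHS](reindex (fun p => b + p)) /=; last first.
  by exists (fun p => p - b) => p _; rewrite ?subrK // addrC ?addKr ?subrK // addrAC subrr add0r.
by apply: eq_bigr => p _; rewrite inE bB.
Qed.

Lemma leq_card_exists (T I : finType) (Q : I -> pred T) :
  (#|[set x | [exists i, Q i x]]| <= \sum_i #|[set x | Q i x]|)%N.
Proof.
rewrite (_ : [set x | _] = \bigcup_i [set x | Q i x]); last first.
  apply/setP => x; rewrite inE; apply/idP/bigcupP => [/existsP[i Qi]|[i _]].
    by exists i; rewrite ?inE.
  by rewrite inE => Qi; apply/existsP; exists i.
elim/big_ind2: _ => [|A a B b hA hB|//]; first by rewrite cards0.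
by apply: leq_trans (leq_add hA hB); rewrite cardsU leq_subr.
Qed.

Lemma card_set_col_mx (F : finNzRingType) k t (Q : pred 'M[F]_(1 + k, t)) :
  #|[set P | Q P]| = (\sum_(p : 'rV_t) #|[set P' : 'M_(k, t) | Q (col_mx p P')]|)%N.
Proof.
under [RHS]eq_bigr => p _ do rewrite -sum1_card.
rewrite pair_big_dep -sum1_card /=.
rewrite (reindex (fun pP : 'rV_t * 'M_(k, t) => col_mx pP.1 pP.2)) /=.
  by apply: eq_bigl => -[p P]; rewrite !inE.
exists (fun P => (usubmx P, dsubmx P)) => [[p P] _|P _] /=.
  by rewrite col_mxKu col_mxKd.
exact: vsubmxK.
Qed.

(* One row of P at a time: merging B (0, z) with B (1, z) shifted by a random p
   squares the relative density rho, except with probability eta for each z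
   (Markov). After k merges the density is below 1 / 2 ^ t, so no b survives. *)
Lemma card_cover_doubling (R : realFieldType) t k (eta rho : R)
    (B : 'rV['F_2]_k -> {set 'rV['F_2]_t}) :
  0 < eta -> 0 < rho ->
  (forall z, #|B z|%:R <= eta * rho * 2 ^+ t) ->
  eta * rho ^+ (2 ^ k) * 2 ^+ t < 1 ->
  #|[set P : 'M['F_2]_(k, t) | [exists b, [forall z, b + z *m P \in B z]]]|%:R
    <= (2 ^+ k - 1) * eta * #|{: 'M['F_2]_(k, t)}|%:R.
Proof.
move=> eta0; elim: k rho B => [|k IH] rho B rho0 hB hsmall.
  rewrite subrr !mul0r lern0 cards_eq0; apply/eqP/setP => P.
  rewrite !inE; apply/negbTE/negP => /existsP[b /forallP /(_ 0) hb].
  have : (0 < #|B 0%R|)%N by apply/card_gt0P; eexists; exact: hb.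
  rewrite -(ler_nat R); have := hB 0; rewrite expn0 expr1 in hsmall; lra.
pose B0 z := B (row_mx 0 z : 'rV_(1 + k)).
pose B1 z := B (row_mx 1%:M z : 'rV_(1 + k)).
pose B' (p : 'rV['F_2]_t) z := [set b in B0 z | b + p \in B1 z].
pose N : R := 2 ^+ t.
have N0 : 0 < N by rewrite exprn_gt0.
pose bad := [set p | [exists z, eta * rho ^+ 2 * N < #|B' p z|%:R]].
have hbad : #|bad|%:R <= 2 ^+ k * eta * N.
  apply: (@le_trans _ _ (\sum_(z : 'rV['F_2]_k)
      #|[set p | eta * rho ^+ 2 * N < #|B' p z|%:R]|%:R)).
    rewrite -natr_sum ler_nat.
    exact: (leq_card_exists (fun z p => eta * rho ^+ 2 * N < #|B' p z|%:R)).
  apply: (@le_trans _ _ (\sum_(z : 'rV['F_2]_k) eta * N)); last first.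
    by rewrite sumr_const -[leLHS]mulr_natl card_rV_F2 natrX mulrA.
  apply: ler_sum => z _.
  have c0 : 0 < eta * rho ^+ 2 * N by rewrite !mulr_gt0 // exprn_gt0.
  rewrite -(ler_pM2r c0).
  have := markov_card (fun p => ler0n R #|B' p z|) (ltW c0).
  move=> /le_trans; apply.
  rewrite -natr_sum sum_card_shift natrM.
  (* The product of the two set sizes is at most [(eta * rho * N) ^+ 2], which is [eta * N] times
     the Markov threshold. *)
  rewrite [leRHS](_ : _ = (eta * rho * N) * (eta * rho * N)); last by ring.
  by apply: ler_pM; rewrite ?ler0n ?hB.
have ev p P' : [exists b, [forall z, b + z *m (col_mx p P' : 'M_(1 + k, t)) \in B z]] ->
    [exists b, [forall z, b + z *m P' \in B' p z]].
  move=> /existsP[b /forallP hb]; apply/existsP; exists b; apply/forallP => z.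
  rewrite inE; move: (hb (row_mx 0 z)) (hb (row_mx 1%:M z)).
  by rewrite !mul_row_col mul0mx mul1mx add0r addrA addrAC => -> ->.
pose M : R := #|{: 'M['F_2]_(k, t)}|%:R.
have M0 : 0 <= M by rewrite ler0n.
have eta1 : 0 <= (2 ^+ k - 1) * eta.
  by rewrite mulr_ge0 ?(ltW eta0) // subr_ge0 exprn_ege1 // ler1n.
(* A bad [p] is charged all completions [P'], any other [p] the induction hypothesis at [rho ^+ 2];
   the coefficients add up as 2^k + (2^k - 1) = 2^(k+1) - 1. *)
apply: (@le_trans _ _ (\sum_p ((p \in bad)%:R * M + (2 ^+ k - 1) * eta * M))).
  rewrite (card_set_col_mx (fun P : 'M_(1 + k, t) =>
    [exists b, [forall z, b + z *m P \in B z]])) natr_sum.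
  apply: ler_sum => p _; case: (boolP (p \in bad)) => hp.
    rewrite mul1r; apply: ler_wpDr; first exact: mulr_ge0.
    by rewrite /M (ler_nat R) max_card.
  rewrite mul0r add0r; apply: le_trans (IH (rho ^+ 2) (B' p) _ _ _).
  - rewrite ler_nat subset_leq_card //; apply/subsetP => P'.
    by rewrite !inE; exact: ev.
  - exact: exprn_gt0.
  - move=> z; rewrite leNgt; apply: contra hp => hz.
    by rewrite inE; apply/existsP; exists z.
  - by rewrite -exprM -expnS.
rewrite big_split /= -mulr_suml sumr_const -[X in _ + X <= _]mulr_natl card_rV_F2 natrX.
rewrite -(natr_card_sum R predT (mem bad)) card_mxS card_rV_F2 natrM natrX -/N -/M.
rewrite (_ : [set x | _] = bad); last by apply/setP => x; rewrite !inE.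
have := ler_wpM2r M0 hbad; rewrite exprS; lra.
Qed.

(** * Refinement by random affine coordinates *)

Section Sampling.
Variables (R : realFieldType) (n : nat).

(* Affine maps x |-> x *m w.1 + w.2 rather than linear ones: 0 is then hashed
   uniformly too, and distinct points are hashed pairwise independently. *)
Definition hit k (w : 'M['F_2]_(n, k) * 'rV['F_2]_k) (x : 'rV_n) (z : 'rV_k) :=
  x *m w.1 + w.2 == z.

Lemma card_hit k x z :
  #|[set w : 'M['F_2]_(n, k) * 'rV['F_2]_k | hit w x z]|%:R
    = (2 ^+ k)^-1 * #|{: 'M['F_2]_(n, k) * 'rV['F_2]_k}|%:R :> R.
Proof.
have inj : injective (fun E : 'M['F_2]_(n, k) => (E, z - x *m E)) by move=> E E' [].
rewrite (_ : [set w | _] = [set (E, z - x *m E) | E : 'M_(n, k)]).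
  rewrite card_imset // card_prod card_rV_F2 natrM natrX mulrC mulfK //.
  by rewrite expf_neq0 // pnatr_eq0.
apply/setP => -[E c]; rewrite inE /hit /=; apply/eqP/imsetP => [<-|[E' _ [-> ->]]].
  by exists E => //; rewrite addrC addKr.
by rewrite addrC subrK.
Qed.

Lemma card_hit2 k x x' z : x != x' ->
  #|[set w : 'M['F_2]_(n, k) * 'rV['F_2]_k | hit w x z && hit w x' z]|%:R
    = (2 ^+ k)^-1 ^+ 2 * #|{: 'M['F_2]_(n, k) * 'rV['F_2]_k}|%:R :> R.
Proof.
move=> nxx; have nz : x - x' != 0 by rewrite subr_eq0.
have inj : injective (fun E : 'M['F_2]_(n, k) => (E, z - x *m E)) by move=> E E' [].
rewrite (_ : [set w | _] = [set (E, z - x *m E) | E in [set E | (x - x') *m E == 0]]).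
  rewrite card_imset // card_prod -(card_mx_ker k nz) card_rV_F2 !natrM natrX.
  by field; rewrite expf_neq0 // pnatr_eq0.
apply/setP => -[E c]; rewrite inE /hit /=.
apply/andP/imsetP => [[/eqP h1 /eqP h2]|[E' h [-> ->]]].
  exists E; last by rewrite -h1 addrC addKr.
  by rewrite inE mulmxBl subr_eq0 -(inj_eq (addIr c)) h1 h2.
move: h; rewrite inE mulmxBl subr_eq0 => /eqP ->.
by rewrite addrC subrK.
Qed.

(** The sub-buckets of [F] share the mean 2^-k |F|, which is off from [mu] by at least [tau * mu].
    By Chebyshev each one strays far from that mean with probability at most 2^-(k+1), and a union
    bound over the 2^k values of [z] leaves half of the seeds. *)
Lemma card_deviant_split k (F : {set 'rV['F_2]_n}) (tau mu : R) :
  0 < tau <= 1 -> 0 < mu -> tau * mu <= `|(2 ^+ k)^-1 * #|F|%:R - mu| ->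
  2 ^+ (k + 4) <= mu * tau ^+ 2 ->
  #|{: 'M['F_2]_(n, k) * 'rV['F_2]_k}|%:R <= 2 * #|[set w : 'M['F_2]_(n, k) * 'rV['F_2]_k |
     [forall z, tau / 2 * mu <= `|#|[set x in F | hit w x z]|%:R - mu|]]|%:R :> R.
Proof.
move=> /andP[tau0 tau1] mu0; set N := _ * #|F|%:R; set D := `|_| => hD hmu.
set W := (X in X <= _).
(* A sub-bucket closer than [tau / 2 * mu] to [mu] must lie at least [l] away from its mean [N];
   moreover [l >= D / 2]. *)
pose l := D - tau / 2 * mu.
have W0 : 0 <= W by rewrite ler0n.
have p0 : 0 <= (2 ^+ k)^-1 :> R by rewrite invr_ge0 exprn_ge0.
have tm0 : 0 < tau * mu by rewrite mulr_gt0.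
have l0 : 0 < l by rewrite /l; lra.
have N0 : 0 <= N by rewrite mulr_ge0.
have ND : N <= mu + D by rewrite /D; have := ler_norm (N - mu); lra.
have hl : N * 2 ^+ k * 2 <= l ^+ 2.
  have h1 : N * (mu * tau ^+ 2) <= 2 * D ^+ 2.
    have h2 : N * (mu * tau ^+ 2) <= (mu + D) * (mu * tau ^+ 2).
      by apply: ler_wpM2r => //; rewrite mulr_ge0 ?exprn_ge0 // ltW.
    have h3 : (tau * mu) ^+ 2 <= D ^+ 2 by rewrite lerXn2r ?nnegrE ?normr_ge0 // ltW.
    have D0 : 0 <= D by exact: normr_ge0.
    have h4 : tau * (D * D) <= 1 * (D * D) by rewrite ler_wpM2r ?mulr_ge0.
    have h5 : tau * D * (tau * mu) <= tau * D * D.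
      by rewrite ler_wpM2l // mulr_ge0 // ltW.
    apply: le_trans h2 _; lra.
  have h5 := ler_wpM2l N0 hmu.
  have h6 : (D / 2) ^+ 2 <= l ^+ 2.
    by rewrite lerXn2r ?nnegrE ?divr_ge0 ?normr_ge0 ?(ltW l0) // /l; lra.
  rewrite exprD in h5; rewrite expr_div_n in h6; lra.
set G := [set w | _].
have hG : #|~: G|%:R <= W / 2.
  apply: (@le_trans _ _ (\sum_(z : 'rV['F_2]_k)
     #|[set w : 'M['F_2]_(n, k) * 'rV['F_2]_k | l <= `|#|[set x in F | hit w x z]|%:R - N|]|%:R)).
    rewrite -natr_sum ler_nat; apply: leq_trans (leq_card_exists
       (fun z w => l <= `|#|[set x in F | hit w x z]|%:R - N|)).
    apply/subset_leq_card/subsetP => w; rewrite !inE negb_forall.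
    move=> /existsP[z hz]; apply/existsP; exists z; move: hz; rewrite -ltNge => hz.
    have := ler_distD #|[set x in F | hit w x z]|%:R N mu.
    by rewrite /l -/D [`|N - _|]distrC; lra.
  apply: (@le_trans _ _ (\sum_(z : 'rV['F_2]_k) W / 2 / 2 ^+ k)); last first.
    rewrite sumr_const -[leLHS]mulr_natl card_rV_F2 natrX mulrC divfK //.
    by rewrite expf_neq0 // pnatr_eq0.
  apply: ler_sum => z _.
  have := chebyshev_card (fun x => card_hit x z) (fun x x' => @card_hit2 k x x' z)
    F p0 (ltW l0).
  rewrite -/N -/W; set Q := #|_|%:R => hQ.
  rewrite ler_pdivlMr ?exprn_gt0 //.
  have l20 : 0 < l ^+ 2 by rewrite exprn_gt0.
  rewrite -(ler_pM2r l20) mulrAC.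
  have e0 : 0 <= 2 ^+ k :> R by rewrite exprn_ge0.
  have := ler_wpM2r e0 hQ; have := ler_wpM2l W0 hl; lra.
have : (#|G| + #|~: G| = #|{: 'M['F_2]_(n, k) * 'rV['F_2]_k}|)%N by rewrite cardsC.
move/(congr1 (fun a : nat => a%:R : R)); rewrite natrD -/W; lra.
Qed.

Variables (S : {set 'rV['F_2]_n}) (t k : nat) (l mu : R).

Local Notation seeds := ('M['F_2]_(n, k) * 'rV['F_2]_k)%type.

(** Over F_2, [hit (A, b) x 0] says that [x] lies in bucket [b] of [A]. Writing the label as a
    translation makes [(A, b)] itself a pairwise independent seed. *)
Definition deviant (A : 'M['F_2]_(n, t)) (w : seeds) (z : 'rV_k) : {set 'rV_t} :=
  [set b | l <= `|#|[set x in S | hit (A, b) x 0 && hit w x z]|%:R - mu|].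

(* The shear A |-> A + E P permutes the maps A and merely relabels the buckets of
   the refined map (A | E). *)
Lemma deviant_shear A w P b z :
  (b \in deviant (A + w.1 *m P) w z)
    = (b - w.2 *m P + z *m P \in deviant A w z).
Proof.
rewrite !inE; set X := [set x in S | _]; set Y := [set x in S | _].
suff -> : X = Y by [].
apply/setP => x; rewrite !inE; congr (_ && _).
rewrite /hit /= andbC [RHS]andbC; case: eqP => //= <-.
rewrite mulmxDr mulmxDl mulmxA.
move: (x *m A) (x *m w.1 *m P) (w.2 *m P) => u v q.
by rewrite [v + q]addrC (addrA (b - q)) subrK -addrA [v + b]addrC.
Qed.

(** The triples [(A, b, w)] form one pairwise independent family with hitting probability 2^-(t+k),
    so Chebyshev bounds all deviant labels at once. *)
Lemma sum_card_deviant z : 0 <= l -> mu = (2 ^+ t)^-1 * (2 ^+ k)^-1 * #|S|%:R ->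
  (\sum_Aw #|deviant Aw.1 Aw.2 z|)%:R * l ^+ 2
    <= mu * (2 ^+ t * #|{: 'M['F_2]_(n, t) * seeds}|%:R).
Proof.
move=> l0 hmu; pose W := (('M['F_2]_(n, t) * 'rV['F_2]_t) * seeds)%type.
pose H (ww : W) x := hit ww.1 x 0 && hit ww.2 x z.
pose p : R := (2 ^+ t)^-1 * (2 ^+ k)^-1.
have p0 : 0 <= p by rewrite mulr_ge0 ?invr_ge0 ?exprn_ge0.
have H1 x : #|[set ww | H ww x]|%:R = p * #|{: W}|%:R.
  rewrite (_ : [set ww | _] = setX [set w1 | hit w1 x 0] [set w | hit w x z]).
    by rewrite cardsX natrM !card_hit [#|{: W}|]card_prod natrM /p; ring.
  by apply/setP => ww; rewrite !inE.
have H2 x x' : x != x' -> #|[set ww | H ww x && H ww x']|%:R = p ^+ 2 * #|{: W}|%:R.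
  move=> nx.
  rewrite (_ : [set ww | _] = setX [set w1 | hit w1 x 0 && hit w1 x' 0]
                                [set w | hit w x z && hit w x' z]).
    by rewrite cardsX natrM !card_hit2 // [#|{: W}|]card_prod natrM /p; ring.
  by apply/setP => ww; rewrite !inE /H andbACA.
have := chebyshev_card H1 H2 S p0 l0.
rewrite (_ : #|[set w | _]| = \sum_Aw #|deviant Aw.1 Aw.2 z|)%N; last first.
  under [RHS]eq_bigr => Aw _ do rewrite -sum1_card.
  rewrite pair_big_dep -sum1_card /=.
  rewrite (reindex (fun q : ('M['F_2]_(n, t) * seeds) * 'rV['F_2]_t =>
      ((q.1.1, q.2), q.1.2))) /=.
    by apply: eq_bigl => -[[A w] b]; rewrite !inE -hmu.
  exists (fun q => ((q.1.1, q.2), q.1.2)) => [[[A w] b]|[[A b] w]] //.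
move=> /le_trans; apply; rewrite -hmu le_eqVlt; apply/orP; left; apply/eqP.
by rewrite /W !card_prod card_rV_F2 !natrM natrX; ring.
Qed.

(** Each [P] shears the pairs [(A, w)] bijectively, so the count can be averaged over [P]. Pairs
    with some dense deviant set have density at most [2 ^+ k * eta] by Markov; for the others the
    doubling bound costs at most as much again, hence [k.+1]. *)
Lemma card_deviant_cover (eta rho : R) :
  0 < l -> 0 < eta -> 0 < rho -> mu = (2 ^+ t)^-1 * (2 ^+ k)^-1 * #|S|%:R ->
  eta * rho ^+ (2 ^ k) * 2 ^+ t < 1 -> mu <= eta * (eta * rho * l ^+ 2) ->
  #|[set Aw : 'M['F_2]_(n, t) * seeds |
      [exists b, [forall z, b \in deviant Aw.1 Aw.2 z]]]|%:R
    <= 2 ^+ k.+1 * eta * #|{: 'M['F_2]_(n, t) * seeds}|%:R.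
Proof.
move=> l0 eta0 rho0 hmu hsmall hl; set Phi := [set Aw | _].
pose O : R := #|{: 'M['F_2]_(n, t) * seeds}|%:R.
pose M : R := #|{: 'M['F_2]_(k, t)}|%:R.
have O0 : 0 <= O by exact: ler0n.
have M0 : 0 < M by rewrite ltr0n; apply/card_gt0P; exists 0.
pose Psi (Aw : 'M['F_2]_(n, t) * seeds) (P : 'M['F_2]_(k, t)) :=
  [exists b, [forall z, b + z *m P \in deviant Aw.1 Aw.2 z]].
have hPsi P : #|Phi| = #|[set Aw | Psi Aw P]|.
  pose g (Aw : 'M['F_2]_(n, t) * seeds) := (Aw.1 + Aw.2.1 *m P, Aw.2).
  have ginj : injective g.
    by move=> [A w] [A' w'] [] /= + ew; rewrite ew => /addIr ->.
  rewrite -(card_preimset Phi ginj); congr #|pred_of_set _|.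
  apply/setP => -[A w]; rewrite !inE /Psi /=; apply/existsP/existsP => -[b /forallP hb].
    (* The affine part of the seed only translates the label of the bucket. *)
    by exists (b - w.2 *m P); apply/forallP => z; rewrite -deviant_shear.
  exists (b + w.2 *m P); apply/forallP => z.
  by rewrite deviant_shear addrK.
pose c := eta * rho * 2 ^+ t.
have c0 : 0 < c by rewrite !mulr_gt0 // exprn_gt0.
pose bad := [set Aw : 'M['F_2]_(n, t) * seeds | [exists z, c < #|deviant Aw.1 Aw.2 z|%:R]].
have hbad : #|bad|%:R <= 2 ^+ k * eta * O.
  apply: (@le_trans _ _ (\sum_(z : 'rV['F_2]_k)
      #|[set Aw : 'M['F_2]_(n, t) * seeds | c < #|deviant Aw.1 Aw.2 z|%:R]|%:R)).
    rewrite -natr_sum ler_nat.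
    exact: (leq_card_exists (fun z (Aw : 'M['F_2]_(n, t) * seeds) =>
      c < #|deviant Aw.1 Aw.2 z|%:R)).
  apply: (@le_trans _ _ (\sum_(z : 'rV['F_2]_k) eta * O)); last first.
    by rewrite sumr_const -[leLHS]mulr_natl card_rV_F2 natrX mulrA.
  apply: ler_sum => z _; set Q := #|_|%:R.
  have hQ : Q * c <= (\sum_Aw #|deviant Aw.1 Aw.2 z|)%:R.
    rewrite natr_sum.
    exact: (@markov_card _ _ (fun Aw => #|deviant Aw.1 Aw.2 z|%:R) _ _ (ltW c0)).
  have l20 : 0 < l ^+ 2 by rewrite exprn_gt0.
  have h1 := ler_wpM2r (ltW l20) hQ.
  have h2 := sum_card_deviant z (ltW l0) hmu.
  have cl0 : 0 < c * l ^+ 2 by rewrite mulr_gt0.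
  rewrite -(ler_pM2r cl0).
  have NO0 : 0 <= 2 ^+ t * O by rewrite mulr_ge0 ?exprn_ge0.
  have h3 := ler_wpM2r NO0 hl.
  rewrite /c in h1 *; rewrite -/O in h2; lra.
have hsum : M * #|Phi|%:R = \sum_Aw #|[set P | Psi Aw P]|%:R.
  rewrite mulr_natl -sumr_const.
  under eq_bigr => P _ do
    rewrite (hPsi P) (natr_card_sum R predT (fun Aw => Psi Aw P)).
  rewrite exchange_big /=; apply: eq_bigr => Aw _.
  by rewrite (natr_card_sum R predT (Psi Aw)).
rewrite -(ler_pM2l M0) hsum.
apply: (@le_trans _ _ (\sum_Aw ((Aw \in bad)%:R * M + 2 ^+ k * eta * M))).
  apply: ler_sum => Aw _; case: (boolP (Aw \in bad)) => hA.
    rewrite mul1r; apply: ler_wpDr.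
      by rewrite !mulr_ge0 ?exprn_ge0 // ltW.
    by rewrite /M (ler_nat R) max_card.
  rewrite mul0r add0r; apply: le_trans (card_cover_doubling eta0 rho0 _ hsmall) _.
    move=> z; rewrite leNgt; apply: contra hA => hz.
    by rewrite inE; apply/existsP; exists z.
  rewrite -/M; have := mulr_gt0 eta0 M0; lra.
rewrite big_split /= -mulr_suml sumr_const -[X in _ + X <= _]mulr_natl.
rewrite -(natr_card_sum R predT (mem bad)) -/O.
rewrite (_ : [set x | _] = bad); last by apply/setP => x; rewrite !inE.
have := ler_wpM2r (ltW M0) hbad; rewrite exprS; lra.
Qed.

End Sampling.

(** * From skewed buckets to closeness to uniform *)

(** Double counting of pairs [(A, w)]: a skewed [A] has a fully deviant bucket for at least half of
    its seeds, so skewed maps are at most twice as dense as such pairs. *)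
Lemma card_skewed_maps (R : realFieldType) n t k (S : {set 'rV['F_2]_n}) (tau delta : R) :
  0 < tau <= 1 -> 0 < delta <= 1 -> (t <= 2 ^ k)%N ->
  2 ^+ (3 * k + 7) * 2 ^+ t <= #|S|%:R * (tau * delta) ^+ 2 ->
  #|[set A : 'M['F_2]_(n, t) | [exists b : 'rV_t, tau * (#|S|%:R / 2 ^+ t)
       < `|#|[set x in S | hit (A, b) x 0]|%:R - #|S|%:R / 2 ^+ t|]]|%:R
    <= delta * #|{: 'M['F_2]_(n, t)}|%:R.
Proof.
move=> /andP[tau0 tau1] /andP[delta0 delta1] tk hS; set bad := [set A | _].
have pK j : 0 < 2 ^+ j :> R by rewrite exprn_gt0.
have nzK j : 2 ^+ j != 0 :> R by rewrite gt_eqF.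
pose s : R := #|S|%:R.
pose mu := (2 ^+ t)^-1 * (2 ^+ k)^-1 * s.
have sE : s = mu * 2 ^+ k * 2 ^+ t by rewrite /mu; field; rewrite !nzK.
have td0 : 0 < tau * delta by rewrite mulr_gt0.
(* The exponent 2(k+2) + 1 + 2 collects the powers of 2 lost in [eta ^+ 2], in [rho = 1/2] and in
   [l ^+ 2], with [eta] and [l] as set below. *)
have hmu : 2 ^+ (2 * k + 7) <= mu * (tau * delta) ^+ 2.
  rewrite -(ler_pM2r (pK (k + t)%N)).
  have : s * (tau * delta) ^+ 2 = mu * (tau * delta) ^+ 2 * 2 ^+ (k + t).
    by rewrite sE exprD; ring.
  move: hS; rewrite -/s => hS <-; apply: le_trans hS.
  rewrite -!exprD le_eqVlt; apply/orP; left; apply/eqP; congr (_ ^+ _); clear; lia.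
have mu0 : 0 < mu.
  have := lt_le_trans (pK _) hmu; rewrite pmulr_lgt0 //; exact: exprn_gt0.
(* Chosen so that the final bound [2 * (2 ^+ k.+1 * eta)] equals [delta]. *)
pose eta := delta / 2 ^+ (k + 2).
have eta0 : 0 < eta by rewrite divr_gt0.
pose l := tau / 2 * mu.
have l0 : 0 < l by rewrite mulr_gt0 // divr_gt0.
(* Density [1/2] suffices: as [t <= 2 ^ k], squaring it [k] times gives at most 2^-t. *)
have hcov := @card_deviant_cover R n S t k l mu eta 2^-1 l0 eta0 _ erefl _ _.
pose W := ('M['F_2]_(n, k) * 'rV['F_2]_k)%type.
pose w : R := #|{: W}|%:R.
have w0 : 0 < w by rewrite ltr0n; apply/card_gt0P; exists (0, 0).
have hA A : A \in bad -> w <= 2 * #|[set w : W | [exists b,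
     [forall z, b \in deviant S l mu A w z]]]|%:R.
  rewrite inE => /existsP[b hb].
  pose F := [set x in S | hit (A, b) x 0].
  have h16 : 2 ^+ (k + 4) <= mu * tau ^+ 2.
    apply: (@le_trans _ _ (2 ^+ (2 * k + 7))).
      by apply: ler_weXn2l; [rewrite ler1n | clear; lia].
    apply: le_trans hmu _; rewrite ler_pM2l // lerXn2r ?nnegrE ?(ltW td0) ?(ltW tau0) //.
    by rewrite ger_pMr.
  have hdev : tau * mu <= `|(2 ^+ k)^-1 * #|F|%:R - mu|.
    have -> : (2 ^+ k)^-1 * #|F|%:R - mu = (#|F|%:R - s / 2 ^+ t) / 2 ^+ k.
      by rewrite sE; field; rewrite !nzK.
    rewrite normrM normfV (gtr0_norm (pK k)) ler_pdivlMr //; apply/ltW.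
    by rewrite (_ : _ * 2 ^+ k = tau * (s / 2 ^+ t)) // sE; field; rewrite nzK.
  have tt : 0 < tau <= 1 by rewrite tau0.
  apply: le_trans (card_deviant_split tt mu0 hdev h16) _.
  rewrite ler_pM2l // ler_nat subset_leq_card //; apply/subsetP => v; rewrite !inE.
  move=> /forallP h; apply/existsP; exists b; apply/forallP => z.
  rewrite inE; move: (h z); rewrite (_ : [set x in F | _] = [set x in S |
    hit (A, b) x 0 && hit v x z]) //.
  by apply/setP => x; rewrite !inE andbA.
pose cov (A : 'M['F_2]_(n, t)) := [set w : W | [exists b, [forall z, b \in deviant S l mu A w z]]].
pose Phi := [set Aw : 'M['F_2]_(n, t) * W |
  [exists b, [forall z, b \in deviant S l mu Aw.1 Aw.2 z]]].
have PhiE : #|Phi| = (\sum_A #|cov A|)%N.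
  under [RHS]eq_bigr => A _ do rewrite -sum1_card.
  by rewrite pair_big_dep -sum1_card; apply: eq_bigl => -[A v]; rewrite !inE.
have hbad : #|bad|%:R * w <= 2 * (2 ^+ k.+1 * eta * #|{: 'M['F_2]_(n, t) * W}|%:R).
  apply: (@le_trans _ _ (2 * #|Phi|%:R)).
    rewrite mulr_natl -sumr_const PhiE.
    rewrite natr_sum mulr_sumr big_mkcond; apply: ler_sum => A _.
    by case: ifP => [/hA //|_]; rewrite mulr_ge0.
  rewrite ler_pM2l //; apply: hcov.
  - by rewrite invr_gt0.
  - apply: (@le_lt_trans _ _ eta).
      rewrite -mulrA ger_pMr // exprVn ler_pdivrMl // mulr1.
      by apply: ler_weXn2l; rewrite // ler1n.
    rewrite /eta ltr_pdivrMr // mul1r; apply: le_lt_trans delta1 _.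
    by rewrite exprn_egt1 ?ltr1n // addn2.
  - have h1 : mu * 2 ^+ (2 * k + 7) <= mu * (mu * (tau * delta) ^+ 2) by rewrite ler_pM2l.
    rewrite -(ler_pM2r (pK (2 * k + 7)%N)); apply: le_trans h1 _.
    rewrite le_eqVlt; apply/orP; left; apply/eqP.
    by rewrite /eta /l !exprD; field; rewrite nzK.
rewrite -(ler_pM2r w0); apply: le_trans hbad _.
rewrite card_prod natrM -/w le_eqVlt; apply/orP; left; apply/eqP.
by rewrite /eta exprS exprD; field; rewrite nzK.
Qed.

Lemma close_unif_surjlin (R : realType) n t (S : {set 'rV['F_2]_n})
    (A : 'M['F_2]_(n, t)) (tau : R) :
  tau < 1 -> close_unif S A (tau / 2 ^+ t) -> surjlin A.
Proof.
move=> tau1 /forallP hA; rewrite /surjlin -/(row_full A) -sub1mx.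
apply: contraT => /row_subPn[i]; set y := row i _ => hy.
have := hA y; rewrite /prLU (_ : [set x in S | _] = set0); last first.
  apply/setP => x; rewrite !inE; apply/negbTE; apply: contra hy => /andP[_ /eqP <-].
  exact: submxMl.
rewrite cards0 mul0r sub0r normrN card_rV_F2 natrX ger0_norm ?divr_ge0 ?exprn_ge0 //.
by rewrite ler_pM2r ?invr_gt0 ?exprn_gt0 // leNgt tau1.
Qed.

Lemma not_close_unif_skewed (R : realType) n t (S : {set 'rV['F_2]_n})
    (A : 'M['F_2]_(n, t)) (tau : R) : (0 < #|S|)%N ->
  ~~ close_unif S A (tau / 2 ^+ t) ->
  [exists b : 'rV_t, tau * (#|S|%:R / 2 ^+ t)
       < `|#|[set x in S | hit (A, b) x 0]|%:R - #|S|%:R / 2 ^+ t|].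
Proof.
move=> S0; rewrite negb_forall => /existsP[y]; rewrite -ltNge => hy.
have s0 : 0 < #|S|%:R :> R by rewrite ltr0n.
have nz : 2 ^+ t != 0 :> R by rewrite gt_eqF // exprn_gt0.
(* The label is [- y] because [hit (A, b) x 0] tests [x *m A + b = 0]. *)
apply/existsP; exists (- y); rewrite (_ : [set x in S | hit (A, - y) x 0]
  = [set x in S | x *m A == y]); last first.
  by apply/setP => x; rewrite !inE /hit /= subr_eq0.
move: hy; rewrite /prLU card_rV_F2 natrX; set c := #|[set x in S | _]|%:R.
have -> : c - #|S|%:R / 2 ^+ t = (c / #|S|%:R - 1 / 2 ^+ t) * #|S|%:R.
  by field; rewrite nz gt_eqF.
rewrite normrM (gtr0_norm s0) -(ltr_pM2r s0); congr is_true; congr (_ < _).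
by rewrite mulrAC mulrA.
Qed.

(* It suffices to count within all matrices: a map that is close to uniform has
   no empty bucket, hence is automatically surjective. *)
Lemma card_close_unif (R : realType) n t k (S : {set 'rV['F_2]_n}) (tau delta : R) :
  0 < tau < 1 -> 0 < delta <= 1 -> (t <= 2 ^ k)%N ->
  2 ^+ (3 * k + 7) * 2 ^+ t <= #|S|%:R * (tau * delta) ^+ 2 ->
  (1 - delta) * #|[set A : 'M['F_2]_(n, t) | surjlin A]|%:R
    <= #|[set A : 'M['F_2]_(n, t) | surjlin A & close_unif S A (tau / 2 ^+ t)]|%:R :> R.
Proof.
move=> /andP[tau0 tau1] hd tk hS.
have S0 : (0 < #|S|)%N.
  rewrite -(ltr_nat R) -(ltr_pM2r (_ : 0 < (tau * delta) ^+ 2)).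
    by rewrite mul0r; apply: lt_le_trans hS; rewrite mulr_gt0 // exprn_gt0.
  by rewrite exprn_gt0 // mulr_gt0 //; case/andP: hd.
have ht : 0 < tau <= 1 by rewrite tau0 ltW.
have := card_skewed_maps ht hd tk hS; set bad := [set A | _] => hbad.
set G := [set A | surjlin A & _].
have hG : (#|{: 'M['F_2]_(n, t)}| <= #|G| + #|bad|)%N.
  rewrite -(cardsC bad) addnC leq_add2r; apply/subset_leq_card/subsetP => A.
  rewrite !inE => hA; have hc : close_unif S A (tau / 2 ^+ t).
    by apply: contraR hA; exact: not_close_unif_skewed.
  by rewrite hc (close_unif_surjlin tau1 hc).
have hs : (#|[set A : 'M['F_2]_(n, t) | surjlin A]| <= #|{: 'M['F_2]_(n, t)}|)%N by exact: max_card.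
move: hG hs; rewrite -!(ler_nat R) natrD => hG hs.
have d1 : 0 <= 1 - delta by rewrite subr_ge0; case/andP: hd.
have := ler_wpM2l d1 hs; lra.
Qed.

(** * Logarithms and choice of parameters *)

Lemma ln2_gt0 (R : realType) : 0 < ln 2 :> R.
Proof. by rewrite ln_gt0 // ltr1n. Qed.

Lemma ler_log2 (R : realType) (x y : R) : 0 < x -> x <= y -> log2 x <= log2 y.
Proof.
move=> x0 xy; rewrite ler_pM2r ?invr_gt0 ?ln2_gt0 // ler_ln // posrE //.
exact: lt_le_trans xy.
Qed.

Lemma pow2_bracket t : (0 < t)%N -> exists k, (t <= 2 ^ k <= 2 * t)%N.
Proof.
move=> t0; exists (trunc_log 2 t).+1.
by rewrite (ltnW (trunc_log_ltn t _)) // expnS leq_pmul2l // trunc_logP.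
Qed.

Theorem mainTheorem4 (R : realType) (n : nat) (S : {set 'rV['F_2]_n})
    (tau delta : R) :
  0 < tau < 1 -> 0 < delta < 1 ->
  let s : R := #|S|%:R in
  let m : R := log2 (s * (s - 1) / delta) in
  s > 2 ^+ 20 * m * Num.max (2 ^+ 8 * (1 + tau) ^+ 4 / (tau * delta) ^+ 8) 1 ->
  m >= 5 * log2 (m * Num.max (4 * (1 + tau) / (tau * delta) ^+ 2) 1) + 25 ->
  exists t : nat,
    (t <= n)%N /\
    t%:R >= log2 s - 4 * log2 (m * Num.max (4 * (1 + tau) / (tau * delta) ^+ 2) 1) - 20 /\
    #|[set A : 'M['F_2]_(n, t) | surjlin A &
        close_unif S A (tau / 2 ^+ t)]|%:R
      >= (1 - delta) * #|[set A : 'M['F_2]_(n, t) | surjlin A]|%:R.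
Proof.
move=> htau /andP[delta0 delta1] s m; set M := Num.max (4 * _ / _) _ => hs hm.
have [tau0 tau1] := andP htau.
have hdelta : 0 < delta <= 1 by rewrite delta0 ltW.
(* If [S] has at most one element, then [s * (s - 1) = 0]; since [ln 0 = 0] by convention, [m = 0]
   and the lower bound on [m] reads [0 >= 25]. *)
have s2 : 2 <= s.
  rewrite leNgt; apply/negP; rewrite /s (ltr_nat R _ 2) => S1.
  have ss0 : s * (s - 1) = 0.
    by rewrite /s; case: #|S| S1 => [|[|//]] _; rewrite ?mul0r ?subrr ?mulr0.
  have m0 : m = 0 by rewrite /m ss0 mul0r /log2 ln0 // mul0r.
  by move: hm; rewrite m0 mul0r /log2 ln0 // mul0r; lra.
have sm : log2 s <= m.
  apply: ler_log2; first by lra.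
  rewrite ler_pdivlMr // -ler_pdivlMl; last by lra.
  rewrite mulKf; lra.
have m1 : 1 <= m.
  apply: le_trans sm; rewrite -[leLHS](@divff _ (ln 2)) ?gt_eqF ?ln2_gt0 //.
  by apply: ler_log2.
pose u := tau * delta.
have u0 : 0 < u by rewrite mulr_gt0.
have u1 : u < 1 by rewrite /u; nra.
have M1 : 1 <= M by rewrite le_max lexx orbT.
have M4 : 4 <= M * u ^+ 2.
  rewrite -ler_pdivrMr ?exprn_gt0 // le_max; apply/orP; left.
  by rewrite ler_pM2r ?invr_gt0 ?exprn_gt0 //; lra.
pose x := log2 s - 4 * log2 (m * M) - 20.
(* When the required bound on [t] is not positive, [t = 0] will do; the lower bound on [s] then
   supplies the size condition. *)
have [x0|x0] := leP x 0.
  exists 0%N; split => //; split=> //.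
  apply: (@card_close_unif R n 0 0) => //; rewrite -/u mulr1 /= -/s.
  have h : 2 ^+ 8 * (1 + tau) ^+ 4 / u ^+ 8 < s.
    apply: le_lt_trans hs; set X := _ / _.
    apply: (@le_trans _ _ (Num.max X 1)); first by rewrite le_max lexx.
    rewrite ler_peMl ?le_max ?ler01 ?orbT //; lra.
  move: h; rewrite ltr_pdivrMr ?exprn_gt0 // => h.
  have h1 : 1 <= (1 + tau) ^+ 4 by rewrite exprn_ege1 // lerDl ltW.
  have h2 : s * u ^+ 8 <= s * u ^+ 2.
    apply: ler_wpM2l; first by lra.
    by apply: ler_wiXn2l; rewrite ?ltW.
  rewrite muln0 add0n; lra.
(* Rounding [x] up to an integer costs at most one bit, which is why 2^19 replaces 2^20 below. *)
have [t t0 /andP[xt tx]] : exists2 t : nat, (0 < t)%N & x <= t%:R <= x + 1.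
  have /andP[x1 x2] := truncn_itv (ltW x0).
  by exists (Num.truncn x).+1; rewrite // ltW //= -natr1 lerD2r.
have mM0 : 0 < m * M by apply: mulr_gt0; lra.
have hmM : 0 <= log2 (m * M).
  by apply: divr_ge0; [apply: ln_ge0; exact: mulr_ege1 | exact/ltW/ln2_gt0].
have tm : t%:R <= m by rewrite /x in tx; lra.
have hst : 2 ^+ t * ((m * M) ^+ 4 * 2 ^+ 19) <= s.
  have p1 : 0 < (m * M) ^+ 4 * 2 ^+ 19 by rewrite mulr_gt0 // exprn_gt0.
  have p2 : 0 < 2 ^+ t :> R by rewrite exprn_gt0.
  have s0 : 0 < s by exact: lt_le_trans s2.
  rewrite -ler_ln ?posrE //; last exact: mulr_gt0.
  have lnX (y : R) j : 0 < y -> ln (y ^+ j) = j%:R * ln y.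
    by move=> y0; rewrite lnXn // mulr_natl.
  rewrite lnM ?posrE // lnM ?posrE ?exprn_gt0 // !lnX //.
  have := ler_wpM2r (ltW (ln2_gt0 R)) tx; rewrite /x /log2.
  have /eqP/= l2 : ln 2 != 0 :> R by rewrite gt_eqF ?ln2_gt0.
  have -> : (ln s / ln 2 - 4 * (ln (m * M) / ln 2) - 20 + 1) * ln 2
     = ln s - 4 * ln (m * M) - 19 * ln 2 by field; apply/eqP.
  move: (ln s) (ln 2) (ln (m * M)) => a b c; clear; lra.
(* [2 ^ k] must reach [t] for the doubling, while [2 ^ k <= 2 * t <= 2 * m] keeps the loss 2^(3k)
   cubic in [m]. *)
have [k /andP[tk kt]] := pow2_bracket t0.
have k2m : 2 ^+ k <= 2 * m.
  by move: kt; rewrite -(ler_nat R) natrX natrM; lra.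
exists t; split.
  rewrite -(leq_exp2l (m := 2)) // -(ler_nat R) natrX.
  have : (#|S| <= 2 ^ n)%N by rewrite -card_rV_F2 max_card.
  rewrite -(ler_nat R) -/s; apply: le_trans; apply: le_trans hst.
  rewrite ler_peMr ?exprn_ge0 // mulr_ege1 // exprn_ege1 ?ler1n // mulr_ege1 //.
split; first by [].
apply: (card_close_unif htau hdelta tk); rewrite -/s -/u.
have u20 : 0 < u ^+ 2 by rewrite exprn_gt0.
apply: le_trans (ler_wpM2r (ltW u20) hst).
(* The loss is at most 2^7 (2m)^3 = 2^10 m^3, against an available 2^19 m^4 M^3 (M u^2), which is at
   least 2^21 m^3. *)
have h1 : (2 ^+ k) ^+ 3 <= (2 * m) ^+ 3.
  by rewrite lerXn2r ?nnegrE ?exprn_ge0 // mulr_ge0 //; lra.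
have h2 : m ^+ 3 * 1 <= m ^+ 4 * M ^+ 3.
  apply: ler_pM; rewrite ?exprn_ge0 ?exprn_ege1 //; try lra.
  by apply: ler_weXn2l.
have h3 : m ^+ 4 * M ^+ 3 * 4 <= m ^+ 4 * M ^+ 3 * (M * u ^+ 2).
  by rewrite ler_wpM2l // mulr_ge0 ?exprn_ge0 //; lra.
have m3 : 0 <= m ^+ 3 by rewrite exprn_ge0 //; lra.
have -> : 2 ^+ (3 * k + 7) * 2 ^+ t = 2 ^+ t * (2 ^+ 7 * (2 ^+ k) ^+ 3) :> R.
  by rewrite -exprM [(k * 3)%N]mulnC exprD; ring.
have -> : 2 ^+ t * ((m * M) ^+ 4 * 2 ^+ 19) * u ^+ 2
    = 2 ^+ t * (2 ^+ 19 * (m ^+ 4 * M ^+ 3 * (M * u ^+ 2))) by ring.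
rewrite ler_pM2l ?exprn_gt0 //; lra.
Qed.
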